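(* Let $n,m,l$ be positive integers with $m<\frac{n}{2}$, $l\geq n+1$, and $l$ an odd prime. If there exists a binary linear code with parameters $[n+1,k,\geq 8m]$ contained in the binary $[n+1,n,2]$ even-weight code, then there exists a lattice of rank $n$ (in ${\bf R}^{n+1}$) with center density at least $\frac{2^{k-\frac{n}{2}}\cdot m^{n/2}}{l^{m-1}(n+1)^{1/2}}$.
   Context: A binary linear $[N,k,d]$ code is a $k$-dimensional subspace of ${\bf F}_2^N$ whose nonzero vectors all have Hamming weight at least $d$; the $[n+1,n,2]$ code is the set of vectors in ${\bf F}_2^{n+1}$ of even weight. For a lattice ${\bf L}$ of rank $r$ with shortest nonzero vector length $\lambda$ and volume $\mathrm{Vol}({\bf L})$ (square root of the Gram determinant of a basis), the center density is $(\lambda/2)^r/\mathrm{Vol}({\bf L})$. *)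

(* Defs.v *)
From mathcomp Require Import all_boot all_order all_algebra.
From mathcomp Require Import classical_sets reals exp.

Set Implicit Arguments.
Unset Strict Implicit.
Unset Printing Implicit Defensive.

Import Order.TTheory GRing.Theory Num.Theory.

Local Open Scope classical_set_scope.
Local Open Scope ring_scope.

Definition hweight (N : nat) (v : 'rV['F_2]_N) : nat :=
  #|[set i : 'I_N | v 0 i != 0]%SET|.

(* [d] is a lower bound on the minimum distance, not its exact value; in
   particular the zero code satisfies the weight condition for every [d]. *)
Definition linear_code (N k d : nat) (C : {vspace 'rV['F_2]_N}) : Prop :=
  \dim C = k /\ (forall v, v \in C -> v != 0 -> (d <= hweight v)%N).

Definition even_weight_code (N : nat) : {set 'rV['F_2]_N} :=
  [set v : 'rV['F_2]_N | ~~ odd (hweight v)]%SET.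

(* MathComp-Analysis's own norm on row vectors is the sup norm. *)
Definition enorm (R : realType) (N : nat) (v : 'rV[R]_N) : R :=
  Num.sqrt (\sum_(i < N) v 0 i ^+ 2).

Definition lattice_basis (R : realType) (r N : nat)
    (L : set 'rV[R]_N) (B : 'M[R]_(r, N)) : Prop :=
  row_free B /\
  L = [set map_mx (intr : int -> R) z *m B | z in [set: 'rV[int]_r]].

Definition is_lattice (R : realType) (r N : nat) (L : set 'rV[R]_N) : Prop :=
  exists B : 'M[R]_(r, N), lattice_basis L B.

Definition shortest_length (R : realType) (N : nat)
    (L : set 'rV[R]_N) (lambda : R) : Prop :=
  (exists v, [/\ L v, v != 0 & enorm v = lambda]) /\
  (forall v, L v -> v != 0 -> lambda <= enorm v).

Definition volume (R : realType) (r N : nat) (B : 'M[R]_(r, N)) : R :=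
  Num.sqrt (\det (B *m B^T)).

(* The volume does not depend on the chosen basis [B], so that a lattice of
   positive rank has exactly one center density. *)
Definition center_density (R : realType) (r N : nat)
    (L : set 'rV[R]_N) (delta : R) : Prop :=
  exists (B : 'M[R]_(r, N)) (lambda : R),
    [/\ lattice_basis L B, shortest_length L lambda &
        delta = (lambda / 2) ^+ r / volume B].

(* Main.v *)
(* Inside the root lattice A_n, take the vectors x with sum_i x_i i^j = 0 mod l
   for 0 < j < m (Craig's lattice) whose reduction mod 2 lies in the code. By
   Newton's identities a nonzero vector of Craig's lattice has squared norm at
   least 2m. Hence a nonzero x of the new lattice has squared norm at least 8m:
   either x mod 2 is a nonzero codeword, or x = 2y with y in Craig's lattice. The
   index in A_n, whose volume is (n + 1)^(1/2), is at most l^(m-1) 2^(n-k). *)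
Require Import Defs.
From mathcomp Require Import all_boot all_order all_algebra.
From mathcomp Require Import zify ring.
From mathcomp Require Import boolp classical_sets reals exp.
Set Implicit Arguments. Unset Strict Implicit. Unset Printing Implicit Defensive.
Import Order.TTheory GRing.Theory Num.Theory.
Local Open Scope classical_set_scope.
Local Open Scope ring_scope.

(** * Newton's identities and Craig's norm bound *)

(* Newton's identities: the polynomial part of [X^m f' / f] is the generating
   polynomial of the power sums of the roots of [f]. *)
Lemma deriv_prod_XsubC (F : comNzRingType) (m : nat) (s : seq F) :
  exists r : {poly F}, (size r <= size s)%N /\
    'X^m * (\prod_(x <- s) ('X - x%:P))^`() =
    (\prod_(x <- s) ('X - x%:P)) *
      (\sum_(j < m) (\sum_(x <- s) x ^+ j)%:P * 'X^(m.-1 - j)) + r.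
Proof.
elim: s => [|a s [r [size_r IHs]]].
  by exists 0; rewrite size_poly0 !big_nil -[1]/(1%:P) derivC mulr0 mul1r addr0
    big1 // => j _; rewrite big_nil mul0r.
set f := \prod_(x <- s) _ in IHs; set P := \sum_(j < m) _ in IHs.
(* The product rule creates a term ['X^m * f], and dividing ['X^m] by ['X - a%:P] leaves the
   constant [a ^+ m]. *)
exists ((a ^+ m)%:P * f + ('X - a%:P) * r); split.
  rewrite (leq_trans (size_polyD _ _)) // geq_max; apply/andP; split.
    rewrite (leq_trans (size_polyMleq _ _)) // size_prod_XsubC.
    by have := size_polyC_leq1 (a ^+ m); case: (size _) => [|[|?]] //=; rewrite ?add0n ?add1n /=.
  by rewrite (leq_trans (size_polyMleq _ _)) // size_XsubC.
have -> : \sum_(j < m) (\sum_(x <- a :: s) x ^+ j)%:P * 'X^(m.-1 - j) =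
  \sum_(j < m) 'X^(m.-1 - j) * a%:P ^+ j + P.
  rewrite -big_split; apply: eq_bigr => j _ /=.
  by rewrite big_cons polyCD mulrDl polyC_exp mulrC.
rewrite big_cons -/f derivM derivB derivX derivC subr0 mul1r.
have XaE := subrXX 'X a%:P m.
set Q := \sum_(j < m) _ in XaE *.
rewrite mulrDr [X in _ + X = _]mulrCA IHs.
have -> : 'X^m = ('X - a%:P) * Q + a%:P ^+ m by rewrite -XaE subrK.
by rewrite polyC_exp; ring.
Qed.

(** The difference of the two products satisfies the same differential identity up to a remainder of
    low degree, which its leading coefficient contradicts. The condition on [j%:R] says that the
    characteristic is zero or at least [m]: [p] copies of a point in characteristic [p < m] have all
    power sums zero. *)
Lemma eq_prod_XsubC_power_sums (F : fieldType) (m : nat) (s1 s2 : seq F) :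
    size s1 = size s2 -> (size s1 < m)%N ->
    (forall j, (0 < j < m)%N -> j%:R != 0 :> F) ->
    (forall j, (j < m)%N -> \sum_(x <- s1) x ^+ j = \sum_(x <- s2) x ^+ j) ->
  \prod_(x <- s1) ('X - x%:P) = \prod_(x <- s2) ('X - x%:P).
Proof.
move=> eq_size; case: m => // m; rewrite ltnS => le_sm char_gt eq_sum.
have [r1 [size_r1 f1E]] := deriv_prod_XsubC m.+1 s1.
have [r2 [size_r2 f2E]] := deriv_prod_XsubC m.+1 s2.
have eqP : \sum_(j < m.+1) (\sum_(x <- s1) x ^+ j)%:P * 'X^(m - j) =
           \sum_(j < m.+1) (\sum_(x <- s2) x ^+ j)%:P * 'X^(m - j).
  by apply: eq_bigr => j _; rewrite eq_sum.
move: f1E f2E; rewrite /= {}eqP.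
set P := \sum_(j < _) _; set f := \prod_(x <- s1) _; set g := \prod_(x <- s2) _.
move=> fE gE; apply/eqP; rewrite -subr_eq0; apply/negPn/negP => h_neq0.
set h := f - g in h_neq0.
(* Comparing coefficients of degree [m + deg h] below gives
   [deg h = size s2] in [F], although [deg h < size s2 <= m]. *)
have hE : 'X^(m.+1) * h^`() = h * P + (r1 - r2).
  by rewrite derivB mulrBr fE gE /h; ring.
have P_big i : (m < i)%N -> P`_i = 0.
  move=> lt_mi; rewrite coef_sum big1 // => j _.
  by rewrite coefCM coefXn (_ : i == _ = false) ?mulr0 //; apply/eqP; lia.
(* The top coefficient of [P] is the zeroth power sum, which counts the roots. *)
have Pm : P`_m = (size s2)%:R.
  rewrite coef_sum big_ord_recl [X in _ + X]big1 => [|j _].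
    rewrite coefCM coefXn subn0 eqxx mulr1 addr0.
    under eq_bigr do rewrite expr0.
    by rewrite big_const_seq count_predT iter_addr_0.
  by rewrite coefCM coefXn (_ : m == _ = false) ?mulr0 //; rewrite lift0; case: eqP (ltn_ord j) => //; lia.
(* Both products are monic of the same degree, so their leading terms cancel in [h]. *)
have size_h : (size h <= size s2)%N.
  apply/leq_sizeP => j; rewrite leq_eqVlt => /orP[/eqP <-|lt_j].
    have lcf : f`_(size s1) = 1.
      by have /monicP := monic_prod_XsubC s1 predT id; rewrite lead_coefE size_prod_XsubC.
    have lcg : g`_(size s2) = 1.
      by have /monicP := monic_prod_XsubC s2 predT id; rewrite lead_coefE size_prod_XsubC.
    by rewrite coefB lcg -eq_size lcf subrr.
  by rewrite coefB !nth_default ?subrr // size_prod_XsubC // eq_size.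
have [d size_hE] : exists d, size h = d.+1.
  by exists (size h).-1; rewrite prednK // size_poly_gt0.
have hd_neq0 : h`_d != 0 by move: h_neq0; rewrite -lead_coef_eq0 lead_coefE size_hE.
have := congr1 (fun q : {poly F} => q`_(d + m)) hE.
have le_r1 : (size r1 <= d + m)%N.
  by rewrite (leq_trans size_r1) // (leq_trans le_sm) ?leq_addl.
have le_r2 : (size r2 <= d + m)%N.
  by rewrite (leq_trans size_r2) // -eq_size (leq_trans le_sm) ?leq_addl.
rewrite coefD coefB (nth_default _ le_r1) (nth_default _ le_r2).
rewrite subrr addr0 coefXnM coefM (bigD1 (Ordinal (ltn_addr m (ltnSn d)))) //= big1; last first.
  move=> j; rewrite -val_eqE /= => neq_jd.
  have [lt_jd|le_dj] := ltnP j d; first by rewrite P_big ?mulr0 // ltn_subRL ltn_add2r.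
  by rewrite nth_default ?mul0r // size_hE ltn_neqAle eq_sym neq_jd.
rewrite addr0 addKn Pm coef_deriv.
(* The first branch occurs only for [d = 0], where [d%:R] vanishes as well. *)
have -> : (if (d + m < m.+1)%N then 0 else h`_(d + m - m.+1).+1 *+ (d + m - m.+1).+1)
   = h`_d * d%:R.
  case: ltnP => [lt_d|ge_d]; first by rewrite (_ : d = 0%N) ?mulr0 //; lia.
  by rewrite (_ : (d + m - m.+1).+1 = d) ?mulr_natr //; lia.
(* Since [d < size s2 <= m], the integer [size s2 - d] is nonzero in [F]. *)
move=> /(mulfI hd_neq0)/eqP; rewrite eq_sym -subr_eq0 -natrB; last lia.
by apply/negP/char_gt; lia.
Qed.

Lemma sumr_flatten_nseq (V : zmodType) (T : Type) (I : finType) (a : I -> nat)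
    (t : I -> T) (F : T -> V) :
  \sum_(x <- flatten [seq nseq (a i) (t i) | i : I]) F x = \sum_i F (t i) *+ a i.
Proof.
rewrite big_flatten big_map big_enum /=.
by apply: eq_bigr => i _; rewrite big_nseq iter_addr_0.
Qed.

(* A violating [x] splits as [a - b] with [a, b >= 0] disjoint, both of total
   multiplicity less than [m]; the multisets of the [t i] with multiplicities
   [a i] and [b i] then have the same first power sums, hence coincide. *)
Lemma craig_norm_lb (F : fieldType) (I : finType) (m : nat) (t : I -> F)
    (x : I -> int) :
    injective t -> (forall j, (0 < j < m)%N -> j%:R != 0 :> F) ->
    \sum_i x i = 0 ->
    (forall j, (0 < j < m)%N -> \sum_i (x i)%:~R * t i ^+ j = 0) ->
    (exists i, x i != 0) ->
  (2 * m)%:Z <= \sum_i x i ^+ 2.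
Proof.
move=> t_inj char_gt sum_x0 psum_x0 [i0 xi0]; rewrite leNgt; apply/negP => lt_x.
pose a i := if 0 <= x i then `|x i|%N else 0%N.
pose b i := if 0 <= x i then 0%N else `|x i|%N.
have xE i : x i = (a i)%:Z - (b i)%:Z by rewrite /a /b; case: ifP => ?; lia.
(* The left side is the absolute value of [x i], at most its square because [x i] is an integer. *)
have ab_le i : (a i)%:Z + (b i)%:Z <= x i ^+ 2.
  by rewrite /a /b expr2; case: ifP => ?; nia.
pose sa := flatten [seq nseq (a i) (t i) | i : I].
pose sb := flatten [seq nseq (b i) (t i) | i : I].
have sizeE (c : I -> nat) :
    (size (flatten [seq nseq (c i) (t i) | i : I]))%:Z = \sum_i (c i)%:Z.
  have := sumr_flatten_nseq c t (fun=> 1%:Z).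
  rewrite big_const_seq count_predT iter_addr_0 natz => ->.
  by apply: eq_bigr => i _; rewrite natz.
have mem_s (c : I -> nat) i : (t i \in flatten [seq nseq (c i) (t i) | i : I]) = (0 < c i)%N.
  apply/flatten_mapP/idP => [[j _]|ci]; last by exists i; rewrite ?mem_enum // mem_nseq ci eqxx.
  by rewrite mem_nseq => /andP[cj /eqP/t_inj ->].
have eq_size : size sa = size sb.
  apply/eqP; rewrite -eqz_nat !sizeE -subr_eq0 -sumrB; apply/eqP.
  by rewrite -[RHS]sum_x0; apply: eq_bigr => i _; rewrite xE.
have size_lt : (size sa < m)%N.
  have : (size sa)%:Z + (size sb)%:Z < (2 * m)%:Z.
    apply: le_lt_trans lt_x; rewrite !sizeE -big_split; by apply: ler_sum => i _; exact: ab_le.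
  lia.
have : \prod_(x <- sa) ('X - x%:P) = \prod_(x <- sb) ('X - x%:P).
  apply: eq_prod_XsubC_power_sums size_lt char_gt _ => // j lt_jm.
  rewrite !sumr_flatten_nseq; apply/eqP; rewrite -subr_eq0 -sumrB; apply/eqP.
  transitivity (\sum_i (x i)%:~R * t i ^+ j : F).
    apply: eq_bigr => i _; rewrite xE rmorphB mulrBl /= -!pmulrn !mulr_natl; ring.
  (* The zeroth power sums agree because the [x i] sum to zero over the integers. *)
  case: j lt_jm => [|j] lt_jm; last exact: psum_x0.
  under eq_bigr do rewrite mulr1.
  by rewrite -rmorph_sum sum_x0.
(* As [x i0] is nonzero, [t i0] occurs in exactly one of the two multisets. *)
move=> /(congr1 (fun q : {poly F} => root q (t i0))); rewrite !root_prod_XsubC !mem_s.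
by rewrite /a /b; case: ifP => ?; lia.
Qed.

(** * Integer sublattices cut out by congruences *)

(* Only an upper bound on the index of the sublattice is needed, so the rows of
   [T] are only required to lie in the kernel, not to span it. *)
Lemma kernel_sublattice_col (F : fieldType) (lift : F -> int) (p n : nat)
    (c : 'cV[F]_n) :
    cancel lift intr -> (0 < p)%N -> p%:R = 0 :> F ->
  exists T : 'M[int]_n, [/\ 0 < \det T, \det T <= p%:Z &
    map_mx intr T *m c = 0].
Proof.
move=> liftK p_gt0 p0.
have [-> | /cV0Pn[i0 ci0]] := eqVneq c 0.
  by exists 1%:M; rewrite det1 mulmx0; split=> //; lia.
(* Elimination with pivot [c i0 0]: row [i] is [e_i - a i * e_i0], which kills [c], and row [i0] is
   [p * e_i0], so the determinant is [p]. *)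
pose a i : int := lift (c i 0 / c i0 0).
pose T : 'M[int]_n := \matrix_(i, j)
  if i == i0 then p%:Z *+ (j == i0) else (i == j)%:R - a i *+ (j == i0).
have detT : \det T = p%:Z.
  rewrite (expand_det_row _ i0) (bigD1 i0) //= big1 => [|j /negPf jn].
    rewrite addr0 mxE !eqxx mulr1n /cofactor addnn -signr_odd odd_double expr0 mul1r.
    suff -> : row' i0 (col' i0 T) = 1%:M by rewrite det1 mulr1.
    apply/matrixP => i j; rewrite !mxE eq_sym (negPf (neq_lift _ _)).
    by rewrite [_ == i0]eq_sym (negPf (neq_lift _ _)) subr0 (inj_eq lift_inj).
  by rewrite mxE eqxx jn mulr0n mul0r.
exists T; rewrite detT lexx ltz_nat p_gt0; split=> //.
apply/matrixP => i j; rewrite (ord1 j) !mxE.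
have [-> | ni] := eqVneq i i0.
  rewrite big1 // => j' _; rewrite !mxE eqxx.
  case: (j' == i0); rewrite ?mul0r //.
  by rewrite mulr1n -pmulrn p0 mul0r.
rewrite (bigD1 i0) //= (bigD1 i) //= big1 => [|j' /andP[n1 n2]].
  rewrite !mxE !eqxx (negPf ni) mulr0n mulr1n sub0r subr0 rmorphN /= liftK.
  by rewrite mulNr divfK // mul1r addr0 addNr.
by rewrite !mxE (negPf ni) (negPf n1) [_ == j']eq_sym (negPf n2) subr0 mul0r.
Qed.

(** The columns are treated one at a time: the remaining congruences are rewritten in the basis
    formed by the rows of [T1], and the indices multiply. *)
Lemma kernel_sublattice (F : fieldType) (lift : F -> int) (p n r : nat)
    (K : 'M[F]_(n, r)) :
    cancel lift intr -> (0 < p)%N -> p%:R = 0 :> F ->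
  exists T : 'M[int]_n, [/\ 0 < \det T, \det T <= (p ^ r)%:Z &
    map_mx intr T *m K = 0].
Proof.
move=> liftK p_gt0 p0; elim: r K => [|r IHr] K.
  by exists 1%:M; rewrite det1 [_ *m K]thinmx0.
pose K' : 'M_(n, 1 + r) := K.
have [T1 [T1_gt0 T1_le T1K]] := kernel_sublattice_col (lsubmx K') liftK p_gt0 p0.
have [T2 [T2_gt0 T2_le T2K]] := IHr (map_mx intr T1 *m rsubmx K').
exists (T2 *m T1); rewrite det_mulmx; split.
- exact: mulr_gt0.
- by rewrite expnSr PoszM ler_pM // ltW.
change (map_mx intr (T2 *m T1) *m K' = 0).
rewrite map_mxM -mulmxA -[K']hsubmxK mul_mx_row T1K.
by rewrite mul_mx_row mulmx0 T2K row_mx0.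
Qed.

Lemma kernel_sublattice_Fp (p n r : nat) (K : 'M['F_p]_(n, r)) : prime p ->
  exists T : 'M[int]_n, [/\ 0 < \det T, \det T <= (p ^ r)%:Z &
    map_mx intr T *m K = 0].
Proof.
move=> p_prime; apply: (@kernel_sublattice _ (fun a : 'F_p => (val a)%:Z)).
- by move=> a; rewrite -pmulrn natr_Zp.
- exact: prime_gt0.
- exact: pchar_Fp_0.
Qed.

(** * The root lattice A_n *)

(* The rows e_i - e_n of this matrix generate the root lattice A_n. *)
Definition rootA (K : pzRingType) (n : nat) : 'M[K]_(n, n + 1) :=
  row_mx 1%:M (const_mx (-1)).

Lemma mul_rootA (K : pzRingType) (n : nat) (u : 'rV[K]_n) :
  u *m rootA K n = row_mx u (- \sum_j u 0 j)%:M.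
Proof.
rewrite /rootA. rewrite mul_mx_row mulmx1; congr row_mx; apply/matrixP => i j.
rewrite (ord1 i) (ord1 j) !mxE eqxx mulr1n -sumrN.
by apply: eq_bigr => k _; rewrite mxE mulrN1.
Qed.

Lemma map_rootA (K K' : pzRingType) (f : {rmorphism K -> K'}) n :
  map_mx f (rootA K n) = rootA K' n.
Proof. by rewrite /rootA map_row_mx map_mx1 map_const_mx rmorphN1. Qed.

Lemma sum_rootA (K : pzRingType) (n : nat) (u : 'rV[K]_n) :
  \sum_i (u *m rootA K n) 0 i = 0.
Proof.
rewrite mul_rootA big_split_ord big_ord1 /=.
rewrite row_mxEr mxE eqxx mulr1n; under eq_bigr do rewrite row_mxEl.
exact: subrr.
Qed.

Lemma rootA_lsubmx (K : pzRingType) (n : nat) (v : 'rV[K]_(n + 1)) :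
  \sum_i v 0 i = 0 -> lsubmx v *m rootA K n = v.
Proof.
rewrite mul_rootA big_split_ord big_ord1 /= => /eqP; rewrite addr_eq0 => /eqP sum_v.
under eq_bigr do rewrite mxE.
rewrite -[RHS]hsubmxK; congr row_mx; apply/matrixP => i j.
by rewrite (ord1 i) (ord1 j) !mxE eqxx mulr1n sum_v opprK.
Qed.

Lemma rootA_inj (K : pzRingType) (n : nat) : injective (fun u : 'rV_n => u *m rootA K n).
Proof. by move=> u v /=; rewrite !mul_rootA => /eq_row_mx[]. Qed.

(** The Gram matrix is a rank-one update [1 + u *m u^T] of the identity, with [u] the all-ones
    column. Factoring one block matrix in two ways turns its determinant into [1 + u^T *m u]. *)
Lemma det_gram_rootA (K : comPzRingType) (n : nat) :
  \det (rootA K n *m (rootA K n)^T) = (n + 1)%:R.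
Proof.
pose u : 'cV[K]_n := const_mx 1.
have -> : rootA K n *m (rootA K n)^T = 1%:M + u *m u^T.
  rewrite /rootA tr_row_mx mul_row_col trmx1 mulmx1; congr (_ + _).
  by apply/matrixP => i j; rewrite !mxE; apply: eq_bigr => k _; rewrite !mxE mulrNN.
have E1 : block_mx 1%:M (- u) u^T 1%:M =
    block_mx (1%:M + u *m u^T) (- u) 0 1%:M *m block_mx 1%:M 0 u^T 1%:M.
  by rewrite mulmx_block !(mulmx1, mulmx0, mul0mx, mul1mx) !add0r mulNmx addrK.
have E2 : block_mx 1%:M (- u) u^T 1%:M =
    block_mx 1%:M 0 u^T 1%:M *m block_mx 1%:M (- u) 0 (1%:M + u^T *m u).
  by rewrite mulmx_block !(mulmx1, mulmx0, mul0mx, mul1mx) !addr0 mulmxN addrC addrK.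
move: (congr1 determinant E1); rewrite E2 !det_mulmx !det_lblock !det_ublock.
rewrite !det1 !mulr1 !mul1r => <-.
rewrite det_mx11 !mxE eqxx addrC natrD; congr (_ + _).
under eq_bigr do rewrite !mxE mulr1.
by rewrite sumr_const card_ord.
Qed.

(** * Parity checks of an even code in the coordinates of A_n *)

Lemma sum_even_weight (N : nat) (v : 'rV['F_2]_N) :
  v \in even_weight_code N -> \sum_i v 0 i = 0.
Proof.
rewrite inE => even_v.
have -> : \sum_i v 0 i = (hweight v)%:R.
  rewrite /hweight -sum1_card natr_sum [RHS]big_mkcond /=; apply: eq_bigr => i _.
  by rewrite inE; case: (v 0 i) => -[|[|//]] ?; apply/val_inj.
by rewrite -(odd_double_half (hweight v)) (negPf even_v) add0n -muln2 natrM (@pchar_Fp_0 2) ?mulr0.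
Qed.

(** An even-weight word is determined by its first [n] coordinates, so the code becomes a
    [k]-dimensional subspace of an [n]-dimensional space. This costs [n - k] checks, one fewer than
    in the ambient space, which gives the factor 2^(n-k) of the index. *)
Lemma parity_checks (n k : nat) (C : {vspace 'rV['F_2]_(n + 1)}) :
    \dim C = k -> {subset C <= even_weight_code (n + 1)} ->
  exists (r : nat) (K : 'M['F_2]_(n, r)), (r + k = n)%N /\
    forall u : 'rV_n, u *m K = 0 -> u *m rootA _ n \in C.
Proof.
move=> dimC C_even.
pose M : 'M['F_2]_(\dim C, n + 1) := \matrix_i (vbasis C)`_i.
have mulM (w : 'rV_(\dim C)) : w *m M = \sum_i w 0 i *: (vbasis C)`_i.
  by rewrite mulmx_sum_row; apply: eq_bigr => i _; rewrite rowK.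
have memM (w : 'rV_(\dim C)) : w *m M \in C.
  rewrite mulM; apply: memv_suml => i _; apply: memvZ.
  by apply: vbasis_mem; rewrite mem_nth ?size_tuple.
have MA (w : 'rV_(\dim C)) : w *m lsubmx M *m rootA _ n = w *m M.
  have -> : w *m lsubmx M = lsubmx (w *m M).
    by rewrite -[M in RHS]hsubmxK mul_mx_row row_mxKl.
  by rewrite rootA_lsubmx // sum_even_weight // C_even.
have rkM : \rank (lsubmx M) = k.
  rewrite -dimC; apply/eqP; apply: inj_row_free => w w0.
  have : w *m M = 0 by rewrite -MA w0 mul0mx.
  rewrite mulM => /(freeP (basis_free (vbasisP C))) w_eq0.
  by apply/rowP => i; rewrite w_eq0 mxE.
(* The cokernel matrix is square; [col_base] keeps only [n - k] independent checks. *)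
exists (\rank (cokermx (lsubmx M))), (col_base (cokermx (lsubmx M))); split.
  by rewrite mxrank_coker rkM subnK // -rkM rank_leq_col.
move=> u uK; have /submxP[w ->] : (u <= lsubmx M)%MS.
  by rewrite submxE -(mulmx_base (cokermx _)) mulmxA uK mul0mx.
by rewrite MA memM.
Qed.

(** * Minimum norm of Craig's lattice and of the new lattice *)

(** Exponents start at 1: the zeroth power sum already vanishes on A_n, so [m - 1] columns suffice
    for Craig's lattice. *)
Definition power_mx (F : pzRingType) (N r : nat) : 'M[F]_(N, r) :=
  \matrix_(i, j) i%:R ^+ j.+1.

(** The evaluation points 0, ..., [N - 1] stay distinct modulo [l] because [N <= l], and the
    integers below [m] stay nonzero because [m < l]. *)
Lemma craig_lattice_min (l N m : nat) (x : 'rV[int]_N) :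
    prime l -> (N <= l)%N -> (0 < m < l)%N ->
    \sum_i x 0 i = 0 -> map_mx intr x *m power_mx 'F_l N m.-1 = 0 -> x != 0 ->
  (2 * m)%:Z <= \sum_i x 0 i ^+ 2.
Proof.
move=> l_prime le_Nl /andP[m_gt0 lt_ml] sum_x0 psum_x0 /rV0Pn x_neq0.
have l_pchar := pchar_Fp l_prime.
apply: (craig_norm_lb (F := 'F_l) (t := fun i : 'I_N => i%:R)) => //.
- move=> i j /(congr1 val) /=; rewrite !val_Fp_nat // !modn_small; first exact: val_inj.
    exact: leq_trans (ltn_ord j) le_Nl.
  exact: leq_trans (ltn_ord i) le_Nl.
- move=> j /andP[j_gt0 lt_jm].
  by rewrite -(dvdn_pcharf l_pchar) gtnNdvd // (ltn_trans lt_jm).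
move=> [//|j] lt_jm; have lt_j : (j < m.-1)%N by lia.
have /rowP/(_ (Ordinal lt_j)) := psum_x0; rewrite !mxE => psum_j; rewrite -[RHS]psum_j.
by apply: eq_bigr => i _; rewrite !mxE.
Qed.

Lemma hweight_le_norm (N : nat) (x : 'rV[int]_N) :
  (hweight (map_mx intr x : 'rV['F_2]_N))%:Z <= \sum_i x 0 i ^+ 2.
Proof.
rewrite /hweight -sum1_card -[leLHS]natz natr_sum big_mkcond /=.
apply: ler_sum => i _; rewrite inE mxE.
case: eqVneq => [_|xi] /=; first exact: sqr_ge0.
have : x 0 i != 0 by apply: contraNneq xi => ->.
rewrite expr2; nia.
Qed.

Lemma constructionA_min (l N m : nat) (C : {pred 'rV['F_2]_N}) (x : 'rV[int]_N) :
    prime l -> odd l -> (N <= l)%N -> (0 < m < l)%N ->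
    (forall v, v \in C -> v != 0 -> (8 * m <= hweight v)%N) ->
    \sum_i x 0 i = 0 -> map_mx intr x *m power_mx 'F_l N m.-1 = 0 ->
    map_mx intr x \in C -> x != 0 ->
  (8 * m)%:Z <= \sum_i x 0 i ^+ 2.
Proof.
move=> l_prime l_odd le_Nl lt_ml C_min sum_x0 psum_x0 xC x_neq0.
have [x_even|x_odd] := eqVneq (map_mx intr x : 'rV['F_2]_N) 0; last first.
  by apply: le_trans (hweight_le_norm x); rewrite lez_nat C_min.
pose y : 'rV[int]_N := \row_i divz (x 0 i) 2.
have xE : x = 2 *: y.
  apply/rowP => i; rewrite !mxE mulrC divzK //.
  have /rowP/(_ i) := x_even; rewrite !mxE => /eqP.
  by rewrite -(dvdz_pcharf (pchar_Fp (isT : prime 2))).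
(* Oddness of [l] lets the congruences modulo [l] pass from [2 *: y] to [y]. *)
have two_neq0 : 2%:R != 0 :> 'F_l.
  rewrite -(dvdn_pcharf (pchar_Fp l_prime)) gtnNdvd //.
  by rewrite ltn_neqAle prime_gt1 // andbT; apply: contraTneq l_odd => <-.
have -> : \sum_i x 0 i ^+ 2 = 4 * \sum_i y 0 i ^+ 2.
  by rewrite mulr_sumr; apply: eq_bigr => i _; rewrite xE mxE exprMn.
have -> : (8 * m)%:Z = 4 * (2 * m)%:Z by lia.
rewrite ler_pM2l //; apply: (craig_lattice_min l_prime le_Nl lt_ml).
- apply: (mulfI (isT : (2 : int) != 0)); rewrite mulr0 -[RHS]sum_x0 mulr_sumr.
  by apply: eq_bigr => i _; rewrite xE [RHS]mxE.
- move: psum_x0; rewrite xE map_mxZ -scalemxAl => /eqP.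
  by rewrite scaler_eq0 (negPf two_neq0) => /eqP.
- by apply: contraNneq x_neq0 => y0; rewrite xE y0 scaler0.
Qed.

(** * Shortest vectors, volume and center density *)

Lemma enorm_intr (R : realType) (N : nat) (x : 'rV[int]_N) :
  enorm (map_mx intr x : 'rV[R]_N) = Num.sqrt (\sum_i x 0 i ^+ 2)%:~R.
Proof.
rewrite /enorm rmorph_sum; congr Num.sqrt.
by apply: eq_bigr => i _; rewrite mxE rmorphXn.
Qed.

(** Squared norms are natural numbers here, so well-ordering provides a vector of minimal length. *)
Lemma integral_shortest_length (R : realType) (r N M : nat)
    (L : set 'rV[R]_N) (B : 'M[int]_(r, N)) :
    (0 < r)%N -> lattice_basis L (map_mx intr B) ->
    (forall z : 'rV_r, z != 0 -> M%:Z <= \sum_i (z *m B) 0 i ^+ 2) ->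
  exists lambda, shortest_length L lambda /\ Num.sqrt M%:R <= lambda.
Proof.
move=> r_gt0 [B_free ->] M_le.
have zB_eq0 (z : 'rV[int]_r) :
    (map_mx intr z *m map_mx intr B == 0 :> 'rV[R]_N) = (z == 0).
  apply/eqP/eqP => [|->]; last by rewrite map_mx0 mul0mx.
  rewrite -(mul0mx _ (map_mx intr B)) => /(row_free_inj B_free)/rowP z0.
  by apply/rowP => i; have /eqP := z0 i; rewrite !mxE intr_eq0 => /eqP.
pose q (z : 'rV[int]_r) := `|(\sum_i (z *m B) 0 i ^+ 2)%R|%N.
have qE z : (q z)%:Z = \sum_i (z *m B) 0 i ^+ 2.
  by rewrite gez0_abs // sumr_ge0 // => i _; rewrite sqr_ge0.
have enormE z :
    enorm (map_mx intr z *m map_mx intr B : 'rV[R]_N) = Num.sqrt (q z)%:R.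
  by rewrite -map_mxM enorm_intr -qE -pmulrn.
pose P := [pred a : nat | `[< exists2 z, z != 0 & q z = a >]].
have exP : exists a, P a.
  exists (q (const_mx 1)); apply/asboolP; exists (const_mx 1) => //.
  by apply/rV0Pn; exists (Ordinal r_gt0); rewrite mxE.
case: (ex_minnP exP) => a /asboolP[z z_neq0 qz] a_min.
exists (Num.sqrt a%:R); split; last first.
  by rewrite ler_sqrt // ler_nat -lez_nat -qz qE M_le.
split.
  exists (map_mx intr z *m map_mx intr B); split; last by rewrite enormE qz.
    by exists z.
  by rewrite zB_eq0.
move=> _ [w _ <-]; rewrite zB_eq0 => w_neq0.
by rewrite enormE ler_sqrt // ler_nat a_min //; apply/asboolP; exists w.
Qed.

Lemma volume_root_sublattice (R : realType) (n : nat) (T : 'M[int]_n) :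
    0 < \det T ->
  volume (map_mx intr (T *m rootA int n) : 'M[R]_(n, n + 1)) =
    (\det T)%:~R * Num.sqrt (n + 1)%:R.
Proof.
move=> detT_gt0; rewrite /volume map_mxM map_rootA trmx_mul mulmxA.
rewrite -(mulmxA _ (rootA R n)) !det_mulmx det_gram_rootA det_tr det_map_mx.
rewrite mulrAC -expr2 sqrtrM ?sqr_ge0 // sqrtr_sqr ger0_norm //.
by rewrite ler0z ltW.
Qed.

Lemma row_free_root_sublattice (R : realType) (n : nat) (T : 'M[int]_n) :
  \det T != 0 -> row_free (map_mx intr (T *m rootA int n) : 'M[R]_(n, n + 1)).
Proof.
move=> detT; rewrite map_mxM map_rootA; apply: inj_row_free => v.
rewrite mulmxA -(mul0mx _ (rootA R n)) => /rootA_inj vT.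
have T_unit : (map_mx intr T : 'M[R]_n) \in unitmx.
  by rewrite unitmxE det_map_mx unitfE intr_eq0.
by rewrite -(mulmxK T_unit v) vT mul0mx.
Qed.

(** With [r = n - k], this rests on sqrt(8m)/2 = sqrt(2m) and (2m)^(n/2) / 2^(n-k) = 2^(k-n/2)
    m^(n/2); [a] stands for l^(m-1). *)
Lemma center_density_arith (R : realType) (n m k r : nat) (a lambda vol : R) :
    (r + k = n)%N -> 0 < a -> 0 < vol ->
    vol <= a * 2 ^+ r * Num.sqrt (n + 1)%:R ->
    Num.sqrt (8 * m)%:R <= lambda ->
  2 `^ (k%:R - n%:R / 2) * m%:R `^ (n%:R / 2) / (a * (n + 1)%:R `^ (1 / 2))
    <= (lambda / 2) ^+ n / vol.
Proof.
move=> rk a_gt0 vol_gt0 vol_le lambda_ge.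
rewrite [1 / 2]mul1r powR12_sqrt //.
have half_powR (x : R) : 0 <= x -> x `^ (n%:R / 2) = Num.sqrt x ^+ n.
  by move=> x_ge0; rewrite mulrC powRrM powR12_sqrt // powR_mulrn // sqrtr_ge0.
have -> : k%:R - n%:R / 2 = n%:R / 2 - r%:R :> R by rewrite -rk natrD; field.
rewrite powRB ?pnatr_eq0 ?implybT // half_powR // half_powR // powR_mulrn //.
rewrite [X in X / (a * _)]mulrAC -exprMn -sqrtrM //.
set s := Num.sqrt (n + 1)%:R in vol_le *.
have s_gt0 : 0 < s by rewrite sqrtr_gt0 ltr0n addn1.
have -> : Num.sqrt (2 * m%:R) ^+ n / 2 ^+ r / (a * s) =
    Num.sqrt (2 * m%:R) ^+ n / (a * 2 ^+ r * s) :> R.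
  by field; rewrite ?expf_neq0 ?gt_eqF.
have le_half : Num.sqrt (2 * m%:R) <= lambda / 2.
  rewrite ler_pdivlMr //; apply: le_trans lambda_ge.
  have -> : (8 * m)%:R = 2 * m%:R * 2 ^+ 2 :> R by rewrite natrM; ring.
  by rewrite [leRHS]sqrtrM ?mulr_ge0 // sqrtr_sqr ger0_norm.
apply: ler_pM => //.
- by rewrite exprn_ge0 ?sqrtr_ge0.
- by rewrite invr_ge0 ltW // (lt_le_trans vol_gt0).
- by rewrite lerXn2r ?nnegrE ?sqrtr_ge0 // (le_trans _ le_half) ?sqrtr_ge0.
- by rewrite lef_pV2 // posrE (lt_le_trans vol_gt0).
Qed.

(** * Construction of the lattice *)

Theorem theorem2p3 (R : realType) (n m l k : nat)
    (n_gt0 : (0 < n)%N) (m_gt0 : (0 < m)%N) (l_gt0 : (0 < l)%N)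
    (m_lt_half_n : m%:R < n%:R / 2 :> R)
    (l_ge : (n + 1 <= l)%N) (l_odd : odd l) (l_prime : prime l)
    (hcode : exists C : {vspace 'rV['F_2]_(n + 1)},
        linear_code k (8 * m) C /\
        {subset C <= even_weight_code (n + 1)}) :
  exists (L : set 'rV[R]_(n + 1)) (delta : R),
    [/\ is_lattice n L,
        center_density n L delta &
        2 `^ (k%:R - n%:R / 2) * m%:R `^ (n%:R / 2)
          / (l%:R ^+ (m - 1) * (n + 1)%:R `^ (1 / 2)) <= delta].
Proof.
case: hcode => C [[dimC C_min] C_even].
have lt_mn : (m < n)%N.
  by rewrite -(ltr_nat R) (lt_le_trans m_lt_half_n) // ler_pdivrMr // ler_peMr // ler1n.
have [r [K [rk KC]]] := parity_checks dimC C_even.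
have [T1 [T1_gt0 T1_le T1K]] :=
  kernel_sublattice_Fp (rootA 'F_l n *m power_mx 'F_l (n + 1) m.-1) l_prime.
(* The parity checks are pulled back along [T1], so the rows of [T2 *m T1] satisfy both families of
   congruences. *)
have [T2 [T2_gt0 T2_le T2K]] :=
  kernel_sublattice_Fp (map_mx intr T1 *m K) (isT : prime 2).
pose T := T2 *m T1; pose B := T *m rootA int n.
have detT_gt0 : 0 < \det T by rewrite det_mulmx mulr_gt0.
have mapB (F : pzRingType) (z : 'rV[int]_n) :
    map_mx intr (z *m B) = map_mx intr (z *m T) *m rootA F n.
  by rewrite mulmxA map_mxM map_rootA.
have B_min (z : 'rV_n) : z != 0 -> (8 * m)%:Z <= \sum_i (z *m B) 0 i ^+ 2.
  move=> z_neq0; apply: (constructionA_min l_prime l_odd l_ge _ C_min).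
  - by rewrite m_gt0 (leq_trans lt_mn) // (leq_trans _ l_ge) // leq_addr.
  - by rewrite mulmxA sum_rootA.
  - by rewrite mapB -mulmxA !map_mxM -!mulmxA T1K !mulmx0.
  - by rewrite mapB KC // !map_mxM -!mulmxA T2K mulmx0.
  - apply: contraNneq z_neq0; rewrite mulmxA -(mul0mx _ (rootA int n)) => /rootA_inj zT.
    (* [T] need not be invertible over the integers; its adjugate gives [\det T] times [z], which
       suffices. *)
    have : z *m T *m \adj T = 0 by rewrite zT mul0mx.
    rewrite -mulmxA mul_mx_adj mul_mx_scalar => /rowP zT0.
    apply/eqP/rowP => i; have /eqP := zT0 i.
    by rewrite !mxE mulf_eq0 gt_eqF // => /eqP.
pose L : set 'rV[R]_(n + 1) :=
  [set map_mx (intr : int -> R) z *m map_mx intr B | z in [set: 'rV[int]_n]].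
have L_basis : lattice_basis L (map_mx intr B).
  by split=> //; apply: row_free_root_sublattice; rewrite gt_eqF.
have [lambda [lambdaP lambda_ge]] := integral_shortest_length n_gt0 L_basis B_min.
exists L, ((lambda / 2) ^+ n / volume (map_mx intr B)); split.
- by exists (map_mx intr B).
- by exists (map_mx intr B), lambda.
rewrite volume_root_sublattice //; apply: (center_density_arith rk) lambda_ge.
- by rewrite exprn_gt0 // ltr0n.
- by rewrite mulr_gt0 ?ltr0z // sqrtr_gt0 ltr0n addn1.
rewrite ler_wpM2r ?sqrtr_ge0 // det_mulmx mulrC subn1 -!natrX -natrM.
by rewrite [leRHS]pmulrn ler_int PoszM ler_pM // ltW.
Qed.
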